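(* Let $\Delta t>0$ be arbitrary, and let $\{Z^n\}_{n\ge 0}$, $\{W^{n+1/2}\}_{n\ge 0}$, $\{R^n\}_{n\ge 0}$ satisfy the SAV/CN-BCFD scheme for the $H^{-1}$ gradient flow: for all $n\ge 0$, $1\le i\le N_x$, $1\le j\le N_y$, $$[d_tZ]_{i,j}^{n+1}=M[D_xd_xW+D_yd_yW]_{i,j}^{n+1/2},$$ $$W_{i,j}^{n+1/2}=-[D_xd_xZ+D_yd_yZ]_{i,j}^{n+1/2}+\lambda Z_{i,j}^{n+1/2}+\frac{R^{n+1/2}}{\sqrt{E_1^h(\tilde Z^{n+1/2})}}F'(\tilde Z_{i,j}^{n+1/2}),$$ $$d_tR^{n+1}=\frac{1}{2\sqrt{E_1^h(\tilde Z^{n+1/2})}}\left(F'(\tilde Z^{n+1/2}),d_tZ^{n+1}\right)_m,$$ with the homogeneous discrete Neumann boundary conditions for $Z$ and $W$. Then the scheme is unconditionally stable, in the sense that for any $\Delta t$ the following discrete energy law holds: $$\frac{1}{\Delta t}\left[E_d(Z^{n+1})-E_d(Z^n)\right]=-M\|\mathbf{d}W^{n+1/2}\|_{TM}^2,\qquad \forall n\ge 0,$$ where $E_d(Z^n)=\frac{\lambda}{2}\|Z^n\|_m^2+\frac12\|\mathbf{d}Z^n\|_{TM}^2+(R^n)^2$.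
   Context: Constants: $M>0$, $\lambda\ge 0$. $F:\mathbb{R}\to\mathbb{R}$ is a differentiable free energy density such that $E_1(\phi)=\int_\Omega F(\phi)\,d\mathbf{x}\ge C_0>0$ for all $\phi$ (a constant having been added to $E_1$ if necessary), so that the square roots below are of positive numbers. Grid: $\Omega\subset\mathbb{R}^2$ is a rectangle divided into $N_x\times N_y$ uniform cells with grid lines $x_{i+1/2}$ ($0\le i\le N_x$), $y_{j+1/2}$ ($0\le j\le N_y$), spacings $h_x=x_{i+1/2}-x_{i-1/2}$, $h_y=y_{j+1/2}-y_{j-1/2}$, and cell centers $(x_i,y_j)$, $x_i=(x_{i-1/2}+x_{i+1/2})/2$, $y_j=(y_{j-1/2}+y_{j+1/2})/2$, $1\le i\le N_x$, $1\le j\le N_y$. Cell-centered grid functions are arrays $(g_{i,j})$. Difference operators: $[d_xg]_{i+1/2,j}=(g_{i+1,j}-g_{i,j})/h_x$, $[d_yg]_{i,j+1/2}=(g_{i,j+1}-g_{i,j})/h_y$ at interior faces; $[D_xg]_{i,j}=(g_{i+1/2,j}-g_{i-1/2,j})/h_x$, $[D_yg]_{i,j}=(g_{i,j+1/2}-g_{i,j-1/2})/h_y$; $[d_tg]^n=(g^n-g^{n-1})/\Delta t$; $\mathbf{d}g=(d_xg,d_yg)$. Discrete Neumann boundary conditions for a cell-centered function $g$ mean that $[d_xg]_{1/2,j}=[d_xg]_{N_x+1/2,j}=0$ for $1\le j\le N_y$ and $[d_yg]_{i,1/2}=[d_yg]_{i,N_y+1/2}=0$ for $1\le i\le N_x$;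 these boundary values are used when evaluating $D_xd_xg$ and $D_yd_yg$. Inner products: $(f,g)_m=\sum_{i=1}^{N_x}\sum_{j=1}^{N_y}h_xh_yf_{i,j}g_{i,j}$; $(f,g)_x=\sum_{i=1}^{N_x-1}\sum_{j=1}^{N_y}h_xh_yf_{i+1/2,j}g_{i+1/2,j}$; $(f,g)_y=\sum_{i=1}^{N_x}\sum_{j=1}^{N_y-1}h_xh_yf_{i,j+1/2}g_{i,j+1/2}$; $(\mathbf v,\mathbf r)_{TM}=(v_1,r_1)_x+(v_2,r_2)_y$; $\|\cdot\|_m,\|\cdot\|_{TM}$ are the induced norms. Scheme notation: $Z^n$ is a cell-centered grid function and $R^n\in\mathbb{R}$ for each integer $n\ge 0$; $Z^{n+1/2}=\frac12(Z^n+Z^{n+1})$, $R^{n+1/2}=\frac12(R^n+R^{n+1})$; $W^{n+1/2}$ is a cell-centered grid function (an unknown of the scheme at the half level); $\tilde Z^{n+1/2}$ is any given (explicitly computed) cell-centered grid function, e.g. $\frac12(3Z^n-Z^{n-1})$; $E_1^h(\tilde Z)=\sum_{i=1}^{N_x}\sum_{j=1}^{N_y}h_xh_yF(\tilde Z_{i,j})$. The boundary conditions are imposed on every $Z^n$ and on every $W^{n+1/2}$. *)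

(* Defs.v *)
From HB Require Import structures.
From mathcomp Require Import all_boot all_order all_algebra.
From mathcomp Require Import all_classical all_reals all_analysis.

Set Implicit Arguments.
Unset Strict Implicit.
Unset Printing Implicit Defensive.

Import Order.TTheory GRing.Theory Num.Theory.
Import numFieldNormedType.Exports.

Local Open Scope classical_set_scope.
Local Open Scope ring_scope.

(* The rectangle [ax, bx] x [ay, by_] cut into Nx x Ny uniform cells. *)
Record grid (R : realType) := Grid {
  ax : R; bx : R; ay : R; by_ : R;
  Nx : nat; Ny : nat;
  ax_lt_bx : ax < bx;
  ay_lt_by : ay < by_;
  Nx_gt0 : (0 < Nx)%N;
  Ny_gt0 : (0 < Ny)%N
}.

Definition Omega (R : realType) (G : grid R) : set (R * R) :=
  [set p | ax G <= p.1 <= bx G /\ ay G <= p.2 <= by_ G].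

Definition hx (R : realType) (G : grid R) : R := (bx G - ax G) / (Nx G)%:R.
Definition hy (R : realType) (G : grid R) : R := (by_ G - ay G) / (Ny G)%:R.

(* Doubly indexed arrays.  In a cell-centered function, [g i j] is the value
   at the cell (i, j), 1 <= i <= Nx, 1 <= j <= Ny; the entries with i = 0,
   i = Nx + 1, j = 0 or j = Ny + 1 are the ghost values through which the
   Neumann conditions are expressed.  In an x-face function, [v i j] is the
   value at (i + 1/2, j), and in a y-face function the value at (i, j + 1/2).
   All other entries are irrelevant. *)
Definition gridfun (R : realType) := nat -> nat -> R.

Section Operators.
Context {R : realType} (G : grid R).
Implicit Types (f g v : gridfun R) (p q : gridfun R * gridfun R).

(* [dx g i j] is [d_x g]_{i+1/2,j}; [dy g i j] is [d_y g]_{i,j+1/2}. *)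
Definition dx g : gridfun R := fun i j => (g i.+1 j - g i j) / hx G.
Definition dy g : gridfun R := fun i j => (g i j.+1 - g i j) / hy G.

(* From faces to cells: the faces i + 1/2 and i - 1/2 have indices i and i.-1. *)
Definition Dx v : gridfun R := fun i j => (v i j - v i.-1 j) / hx G.
Definition Dy v : gridfun R := fun i j => (v i j - v i j.-1) / hy G.

Definition dgrad g : gridfun R * gridfun R := (dx g, dy g).

Definition neumann g : Prop :=
  (forall j, (1 <= j <= Ny G)%N -> dx g 0%N j = 0 /\ dx g (Nx G) j = 0) /\
  (forall i, (1 <= i <= Nx G)%N -> dy g i 0%N = 0 /\ dy g i (Ny G) = 0).

Definition ipm f g : R :=
  \sum_(1 <= i < (Nx G).+1) \sum_(1 <= j < (Ny G).+1)
     hx G * hy G * f i j * g i j.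

(* Only interior faces contribute to [ipx] and [ipy]. *)
Definition ipx f g : R :=
  \sum_(1 <= i < Nx G) \sum_(1 <= j < (Ny G).+1) hx G * hy G * f i j * g i j.

Definition ipy f g : R :=
  \sum_(1 <= i < (Nx G).+1) \sum_(1 <= j < Ny G) hx G * hy G * f i j * g i j.

Definition ipTM p q : R := ipx p.1 q.1 + ipy p.2 q.2.

Definition normm f : R := Num.sqrt (ipm f f).
Definition normTM p : R := Num.sqrt (ipTM p p).

Definition E1 (F : R -> R) (phi : R * R -> R) : \bar R :=
  (\int[(@lebesgue_measure R \x @lebesgue_measure R)%E]_(p in Omega G)
     (F (phi p))%:E)%E.

Definition E1h (F : R -> R) g : R :=
  \sum_(1 <= i < (Nx G).+1) \sum_(1 <= j < (Ny G).+1) hx G * hy G * F (g i j).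

Definition Ed (lambda : R) g (r : R) : R :=
  lambda / 2 * normm g ^+ 2 + 1 / 2 * normTM (dgrad g) ^+ 2 + r ^+ 2.

End Operators.

Section Time.
Context {R : realType}.

Definition dt (tau : R) (u : nat -> R) (n : nat) : R := (u n - u n.-1) / tau.

Definition dtg (tau : R) (Z : nat -> gridfun R) (n : nat) : gridfun R :=
  fun i j => dt tau (fun k => Z k i j) n.

(* [mid u n] is u^{n+1/2}. *)
Definition mid (u : nat -> R) (n : nat) : R := (u n + u n.+1) / 2.

Definition midg (Z : nat -> gridfun R) (n : nat) : gridfun R :=
  fun i j => mid (fun k => Z k i j) n.

End Time.

(* Main.v *)
Require Import Defs.
From HB Require Import structures.
From mathcomp Require Import all_boot all_order all_algebra.
From mathcomp Require Import all_classical all_reals all_analysis.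
From mathcomp Require Import ring.

Set Implicit Arguments.
Unset Strict Implicit.
Unset Printing Implicit Defensive.

Import Order.TTheory GRing.Theory Num.Theory.
Import numFieldNormedType.Exports.

Local Open Scope classical_set_scope.
Local Open Scope ring_scope.

(* Test the Z-equation with W^{n+1/2}, the W-equation with d_t Z^{n+1} and the
   r-equation with R^{n+1/2}: the nonlinear terms cancel, the discrete Laplacian
   is moved onto the test function by summation by parts, in which the Neumann
   conditions annihilate the boundary terms, and each remaining product
   u^{n+1/2} d_t u^{n+1} is a difference of squares divided by 2 tau.  The
   coefficient 1 / sqrt(E_1^h) is the same number in both equations, so its sign
   and even the convention 1 / 0 = 0 are harmless. *)

(** One row of the discrete Green formula: [v] lives on the faces 0 to [N] and [f] on the cells 1 to
    [N], so regrouping by faces leaves boundary terms at the two end faces only. *)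
Lemma sum_by_parts (R : comPzRingType) (v f : nat -> R) (N : nat) :
  (0 < N)%N -> v 0%N = 0 -> v N = 0 ->
  \sum_(1 <= i < N.+1) (v i - v i.-1) * f i =
  - \sum_(1 <= i < N) v i * (f i.+1 - f i).
Proof.
move=> N_gt0 v0 vN.
(* The induction runs on the identity with boundary terms, since [v N = 0] does not pass to shorter
   sums. It starts at one cell, where the sum over interior faces is empty. *)
suff -> : \sum_(1 <= i < N.+1) (v i - v i.-1) * f i =
    v N * f N - v 0%N * f 1%N - \sum_(1 <= i < N) v i * (f i.+1 - f i).
  by rewrite v0 vN !mul0r subrr sub0r.
case: N N_gt0 {vN} => // N _; elim: N => [|N IHN].
  by rewrite big_nat1 big_geq //=; ring.
by rewrite big_nat_recr //= IHN [in RHS]big_nat_recr //=; ring.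
Qed.

Section InnerProducts.
Context {R : realType} (G : grid R).
Implicit Types f g : gridfun R.

Lemma ipm_eqr f g1 g2 :
  (forall i j, (1 <= i <= Nx G)%N -> (1 <= j <= Ny G)%N -> g1 i j = g2 i j) ->
  ipm G f g1 = ipm G f g2.
Proof.
move=> eqg; apply: eq_big_nat => i Hi; apply: eq_big_nat => j Hj.
by rewrite eqg.
Qed.

Lemma ipmC f g : ipm G f g = ipm G g f.
Proof.
by apply: eq_bigr => i _; apply: eq_bigr => j _; rewrite -!mulrA [f i j * _]mulrC.
Qed.

Lemma ipmDr f g1 g2 :
  ipm G f (fun i j => g1 i j + g2 i j) = ipm G f g1 + ipm G f g2.
Proof.
rewrite /ipm -big_split; apply: eq_bigr => i _; rewrite -big_split.
by apply: eq_bigr => j _; rewrite /= mulrDr.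
Qed.

Lemma ipmZr c f g : ipm G f (fun i j => c * g i j) = c * ipm G f g.
Proof.
rewrite /ipm mulr_sumr; apply: eq_bigr => i _; rewrite mulr_sumr.
by apply: eq_bigr => j _; rewrite mulrCA.
Qed.

Lemma ipm_Dxdx f g : (0 < Nx G)%N ->
  (forall j, (1 <= j <= Ny G)%N -> dx G g 0%N j = 0 /\ dx G g (Nx G) j = 0) ->
  ipm G f (Dx G (dx G g)) = - ipx G (dx G g) (dx G f).
Proof.
(* Differences act along the first index, so that sum has to be the inner one. *)
move=> Nx_gt0 bc; rewrite /ipm /ipx exchange_big [in RHS]exchange_big -sumrN.
apply: eq_big_nat => j Hj; have [bc0 bcN] := bc j Hj.
(* The quotient [hx G / hx G] stays unsimplified: it comes from [Dx] on one side and from [dx G f]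
   on the other, so [ring] matches them with the inverse as an atom. *)
transitivity (hy G * (hx G / hx G) *
    \sum_(1 <= i < (Nx G).+1) (dx G g i j - dx G g i.-1 j) * f i j).
  by rewrite mulr_sumr; apply: eq_bigr => i _; rewrite /Dx; ring.
rewrite (sum_by_parts (v := fun i => dx G g i j) (fun i => f i j)) //.
rewrite mulrN mulr_sumr; congr (- _).
by apply: eq_bigr => i _; rewrite [dx G f _ _]/dx; ring.
Qed.

Lemma ipm_Dydy f g : (0 < Ny G)%N ->
  (forall i, (1 <= i <= Nx G)%N -> dy G g i 0%N = 0 /\ dy G g i (Ny G) = 0) ->
  ipm G f (Dy G (dy G g)) = - ipy G (dy G g) (dy G f).
Proof.
move=> Ny_gt0 bc; rewrite /ipm /ipy -sumrN.
apply: eq_big_nat => i Hi; have [bc0 bcN] := bc i Hi.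
transitivity (hx G * (hy G / hy G) *
    \sum_(1 <= j < (Ny G).+1) (dy G g i j - dy G g i j.-1) * f i j).
  by rewrite mulr_sumr; apply: eq_bigr => j _; rewrite /Dy; ring.
rewrite (sum_by_parts (v := fun j => dy G g i j) (fun j => f i j)) //.
rewrite mulrN mulr_sumr; congr (- _).
by apply: eq_bigr => j _; rewrite [dy G f _ _]/dy; ring.
Qed.

Lemma ipm_laplacian f g : neumann G g ->
  ipm G f (fun i j => Dx G (dx G g) i j + Dy G (dy G g) i j) =
  - ipTM G (dgrad G g) (dgrad G f).
Proof.
move=> [bcx bcy]; rewrite ipmDr ipm_Dxdx ?Nx_gt0 // ipm_Dydy ?Ny_gt0 //.
by rewrite /ipTM opprD.
Qed.

Lemma cell_area_ge0 : 0 <= hx G * hy G.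
Proof.
by rewrite mulr_ge0 // divr_ge0 ?ler0n // subr_ge0 ltW // (ax_lt_bx, ay_lt_by).
Qed.

(** [Num.sqrt] is inverted by squaring only on nonnegative arguments; here the argument is a sum of
    squares weighted by the cell area. *)
Lemma sqr_normm f : normm G f ^+ 2 = ipm G f f.
Proof.
rewrite sqr_sqrtr //; apply: sumr_ge0 => i _; apply: sumr_ge0 => j _.
by rewrite -mulrA mulr_ge0 ?cell_area_ge0 // -expr2 sqr_ge0.
Qed.

Lemma sqr_normTM p : normTM G p ^+ 2 = ipTM G p p.
Proof.
rewrite sqr_sqrtr //; apply: addr_ge0; apply: sumr_ge0 => i _;
  apply: sumr_ge0 => j _;
  by rewrite -mulrA mulr_ge0 ?cell_area_ge0 // -expr2 sqr_ge0.
Qed.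

End InnerProducts.

Section TimeDifferences.
Context {R : realType} (G : grid R) (tau : R) (Z : nat -> gridfun R) (n : nat).

(** The boundary conditions are imposed at integer levels, but the Laplacian in the W-equation acts
    on the average; linearity carries them over. *)
Lemma neumann_midg :
  neumann G (Z n) -> neumann G (Z n.+1) -> neumann G (midg Z n).
Proof.
have dx_mid i j : dx G (midg Z n) i j = (dx G (Z n) i j + dx G (Z n.+1) i j) / 2.
  by rewrite /dx /midg /mid; ring.
have dy_mid i j : dy G (midg Z n) i j = (dy G (Z n) i j + dy G (Z n.+1) i j) / 2.
  by rewrite /dy /midg /mid; ring.
move=> [bx0 by0] [bx1 by1]; split=> [j Hj|i Hi].
  have [e0 eN] := bx0 j Hj; have [e0' eN'] := bx1 j Hj.
  by rewrite !dx_mid e0 eN e0' eN' addr0 mul0r.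
have [e0 eN] := by0 i Hi; have [e0' eN'] := by1 i Hi.
by rewrite !dy_mid e0 eN e0' eN' addr0 mul0r.
Qed.

Lemma ipm_midg_dtg : ipm G (dtg tau Z n.+1) (midg Z n) =
  2^-1 * tau^-1 * (ipm G (Z n.+1) (Z n.+1) - ipm G (Z n) (Z n)).
Proof.
rewrite /ipm -sumrB mulr_sumr; apply: eq_bigr => i _.
rewrite -sumrB mulr_sumr; apply: eq_bigr => j _.
by rewrite /dtg /dt /midg /mid /=; ring.
Qed.

(** Spatial differences commute with [midg] and [dtg], so the difference of squares arises face by
    face. *)
Lemma ipTM_midg_dtg :
  ipTM G (dgrad G (midg Z n)) (dgrad G (dtg tau Z n.+1)) =
  2^-1 * tau^-1 * (ipTM G (dgrad G (Z n.+1)) (dgrad G (Z n.+1))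
                   - ipTM G (dgrad G (Z n)) (dgrad G (Z n))).
Proof.
rewrite /ipTM opprD addrACA mulrDr; congr (_ + _) => /=.
  rewrite /ipx -sumrB mulr_sumr; apply: eq_bigr => i _.
  rewrite -sumrB mulr_sumr; apply: eq_bigr => j _.
  by rewrite /dx /dtg /dt /midg /mid /=; ring.
rewrite /ipy -sumrB mulr_sumr; apply: eq_bigr => i _.
rewrite -sumrB mulr_sumr; apply: eq_bigr => j _.
by rewrite /dy /dtg /dt /midg /mid /=; ring.
Qed.

End TimeDifferences.

(* W n and Zt n stand for the half-level functions W^{n+1/2} and Z~^{n+1/2}. *)
Theorem theorem2 (R : realType) (G : grid R) (M lambda C0 : R) (F : R -> R)
  (M_gt0 : 0 < M) (lambda_ge0 : 0 <= lambda)
  (F_derivable : forall x : R, derivable F x 1)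
  (C0_gt0 : 0 < C0)
  (E1_ge : forall phi : R * R -> R,
     {within Omega G, continuous phi} -> (C0%:E <= E1 G F phi)%E)
  (tau : R) (tau_gt0 : 0 < tau)
  (Z W Zt : nat -> gridfun R) (r : nat -> R)
  (Z_neumann : forall n : nat, neumann G (Z n))
  (W_neumann : forall n : nat, neumann G (W n))
  (Z_eq : forall n i j : nat, (1 <= i <= Nx G)%N -> (1 <= j <= Ny G)%N ->
     dtg tau Z n.+1 i j =
     M * (Dx G (dx G (W n)) i j + Dy G (dy G (W n)) i j))
  (W_eq : forall n i j : nat, (1 <= i <= Nx G)%N -> (1 <= j <= Ny G)%N ->
     W n i j =
     - (Dx G (dx G (midg Z n)) i j + Dy G (dy G (midg Z n)) i j)
     + lambda * midg Z n i j
     + mid r n / Num.sqrt (E1h G F (Zt n)) * derive1 F (Zt n i j))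
  (r_eq : forall n : nat,
     dt tau r n.+1 =
     1 / (2 * Num.sqrt (E1h G F (Zt n)))
     * ipm G (fun i j => derive1 F (Zt n i j)) (dtg tau Z n.+1)) :
  forall n : nat,
    1 / tau * (Ed G lambda (Z n.+1) (r n.+1) - Ed G lambda (Z n) (r n)) =
    - M * normTM G (dgrad G (W n)) ^+ 2.
Proof.
move=> n; rewrite /Ed !sqr_normm !sqr_normTM.
have dissipation : ipm G (W n) (dtg tau Z n.+1) =
    - M * ipTM G (dgrad G (W n)) (dgrad G (W n)).
  rewrite (ipm_eqr _ (g2 := fun i j => M * (Dx G (dx G (W n)) i j
    + Dy G (dy G (W n)) i j))); last exact: Z_eq.
  by rewrite ipmZr ipm_laplacian // mulrN mulNr.
(* The right-hand side is now the product of [W n] with [V], to be computed a second time through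
   the W-equation. Writing the minus sign as the scalar [-1] lets [ipmZr] extract it. *)
rewrite -dissipation [RHS]ipmC; set V := dtg tau Z n.+1.
rewrite [RHS](ipm_eqr _ (g2 := fun i j =>
    -1 * (Dx G (dx G (midg Z n)) i j + Dy G (dy G (midg Z n)) i j)
    + lambda * midg Z n i j
    + mid r n / Num.sqrt (E1h G F (Zt n)) * derive1 F (Zt n i j))); last first.
  by move=> i j Hi Hj; rewrite W_eq // mulN1r.
rewrite !ipmDr !ipmZr ipm_laplacian; last exact: neumann_midg.
rewrite ipTM_midg_dtg ipm_midg_dtg [ipm G V _]ipmC.
have r_energy : mid r n / Num.sqrt (E1h G F (Zt n))
    * ipm G (fun i j => derive1 F (Zt n i j)) V =
    tau^-1 * (r n.+1 ^+ 2 - r n ^+ 2).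
  (* The factor 2 cancels the 1/2 in the r-equation, which is why the energy contains the square of
     [r] with coefficient 1. *)
  have -> : tau^-1 * (r n.+1 ^+ 2 - r n ^+ 2) = 2 * mid r n * dt tau r n.+1.
    by rewrite /mid /dt /=; field; rewrite gt_eqF.
  (* [invfM] holds at zero too, so the inverse root becomes an arbitrary scalar [s] and only 2 has
     to be inverted. *)
  by rewrite r_eq invfM; move: (Num.sqrt _)^-1 => s; field.
by rewrite r_energy; field; rewrite gt_eqF.
Qed.
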